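(* Let $\mathscr A$ be an arc of a circle that is less than half of the circle, let $n$ be a natural number, and let $(P_1,\dots,P_{n+1})$ be a regular clockwise oriented partition of $\mathscr A$. For a natural number $m\ge 1$ with $m<n$, let $\ell_m$ denote the length of the line segment $\overline{P_1P_{m+1}}$, and let $\ell_n$ denote the length of the line segment $\overline{P_1P_{n+1}}$. Then $$n\,\ell_m > m\,\ell_n .$$
   Context: A clockwise oriented partition of an arc $\mathscr A$ is a finite sequence of points of $\mathscr A$, in clockwise order, whose first and last points are the endpoints of $\mathscr A$. It is regular if all pairs of adjacent points of the sequence are at the same distance from each other. Natural numbers start at $1$. *)

(* Defs.v *)
From Stdlib Require Import Reals.
Open Scope R_scope.

Definition point : Type := (R * R)%type.

Definition distance (p q : point) : R :=
  dist_euc (fst p) (snd p) (fst q) (snd q).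

(* [arc_start] is the polar angle, seen from the center, of the endpoint from
   which the arc is traversed clockwise; [arc_angle] is the central angle. *)
Record arc : Type := Arc {
  arc_center : point;
  arc_radius : R;
  arc_start : R;
  arc_angle : R;
  arc_radius_pos : 0 < arc_radius;
  arc_angle_pos : 0 < arc_angle;
  arc_angle_lt : arc_angle < 2 * PI
}.

(* Clockwise rotation decreases the polar angle.  The points of the arc are
   those with 0 <= t <= arc_angle A, the endpoints those with t = 0 and
   t = arc_angle A. *)
Definition arc_point (A : arc) (t : R) : point :=
  (fst (arc_center A) + arc_radius A * cos (arc_start A - t),
   snd (arc_center A) + arc_radius A * sin (arc_start A - t)).

Definition less_than_half_circle (A : arc) : Prop := arc_angle A < PI.

Definition clockwise_ordered (A : arc) (n : nat) (P : nat -> point) : Prop :=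
  exists t : nat -> R,
    (forall i, (1 <= i <= n + 1)%nat ->
       0 <= t i <= arc_angle A /\ P i = arc_point A (t i)) /\
    (forall i, (1 <= i <= n)%nat -> t i <= t (i + 1)%nat).

(* A sequence (P_1, ..., P_{n+1}) is a function on nat of which only the values
   at 1, ..., n+1 are used.  Repeated points are not excluded. *)
Definition clockwise_partition (A : arc) (n : nat) (P : nat -> point) : Prop :=
  clockwise_ordered A n P /\
  P 1%nat = arc_point A 0 /\
  P (n + 1)%nat = arc_point A (arc_angle A).

Definition regular (n : nat) (P : nat -> point) : Prop :=
  forall i j, (1 <= i <= n)%nat -> (1 <= j <= n)%nat ->
    distance (P i) (P (i + 1)%nat) = distance (P j) (P (j + 1)%nat).

(* Main.v *)
(* The chord between parameters s <= t of the arc has length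
   2 r sin ((t - s) / 2), so on an arc of angle less than pi equal chords
   subtend equal central angles 2 x, and the claim becomes
   n sin (m x) > m sin (n x).  For S k = (k + 1) sin (k x) - k sin ((k + 1) x)
   one has S 0 = 0 and S (k + 1) - S k = 2 (k + 1) (1 - cos x) sin ((k + 1) x),
   hence S k > 0: the ratio sin (k x) / k decreases in k. *)
Require Import Defs.
From Stdlib Require Import Reals Lra Lia.
Open Scope R_scope.

(** Both sides have equal squares, by the cosine difference formula and [cos (2 h) = 1 - 2 sin^2 h].
    The bound [2 * PI] keeps the sine nonnegative, so taking roots loses no sign. *)
Lemma distance_arc_point (A : arc) (s t : R) :
  s <= t -> t - s <= 2 * PI ->
  distance (arc_point A s) (arc_point A t)
  = 2 * arc_radius A * sin ((t - s) / 2).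
Proof.
  intros Hst Hpi.
  pose proof (arc_radius_pos A) as Hr.
  assert (Hs : 0 <= sin ((t - s) / 2)) by (apply sin_ge_0; lra).
  unfold distance, dist_euc, arc_point; simpl.
  rewrite <- (sqrt_Rsqr (2 * arc_radius A * sin ((t - s) / 2)))
    by (apply Rmult_le_pos; lra).
  f_equal.
  pose proof (sin2_cos2 (arc_start A - s)) as E1.
  pose proof (sin2_cos2 (arc_start A - t)) as E2.
  pose proof (cos_minus (arc_start A - s) (arc_start A - t)) as E3.
  replace (arc_start A - s - (arc_start A - t)) with (2 * ((t - s) / 2)) in E3
    by field.
  rewrite cos_2a_sin in E3.
  unfold Rsqr in *.
  set (r := arc_radius A) in *; set (h := sin ((t - s) / 2)) in *.
  (* Grouped so that [E1], [E2] and [E3] rewrite whole subterms. *)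
  transitivity (r * r *
    ((sin (arc_start A - s) * sin (arc_start A - s)
      + cos (arc_start A - s) * cos (arc_start A - s))
     + (sin (arc_start A - t) * sin (arc_start A - t)
        + cos (arc_start A - t) * cos (arc_start A - t))
     - 2 * (cos (arc_start A - s) * cos (arc_start A - t)
            + sin (arc_start A - s) * sin (arc_start A - t)))).
  - ring.
  - rewrite E1, E2, <- E3; ring.
Qed.

(** Distinct parameters differ by less than a full turn, so the chord between their points has
    positive length. *)
Lemma arc_point_inj (A : arc) (s t : R) :
  0 <= s <= arc_angle A -> 0 <= t <= arc_angle A ->
  arc_point A s = arc_point A t -> s = t.
Proof.
  pose proof (arc_radius_pos A) as Hr.
  pose proof (arc_angle_lt A) as Hlt.
  assert (W : forall u v, 0 <= u -> u < v -> v <= arc_angle A ->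
            arc_point A u <> arc_point A v).
  { intros u v Hu Huv Hv E.
    assert (Hd := distance_arc_point A u v ltac:(lra) ltac:(lra)).
    rewrite E in Hd.
    unfold distance in Hd; rewrite distance_refl in Hd.
    assert (0 < sin ((v - u) / 2)) by (apply sin_gt_0; lra).
    assert (0 < 2 * arc_radius A * sin ((v - u) / 2))
      by (apply Rmult_lt_0_compat; lra).
    lra. }
  intros Hs Ht E.
  destruct (Rtotal_order s t) as [H | [H | H]]; [exfalso | exact H | exfalso].
  - apply (W s t); lra || exact E.
  - apply (W t s); lra || (symmetry; exact E).
Qed.

(** Strictness comes from the case [k = 1], where [sin (2 x) = 2 sin x cos x < 2 sin x]; the
    induction step only uses that the increment is nonnegative. *)
Lemma sin_mult_succ_lt (x : R) (k : nat) :
  0 < x -> (1 <= k)%nat -> INR (k + 1) * x <= PI ->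
  INR k * sin (INR (k + 1) * x) < INR (k + 1) * sin (INR k * x).
Proof.
  intros Hx Hk.
  induction Hk as [| k Hk IH]; intros Hpi.
  - simpl INR in *; rewrite !Rmult_1_l.
    replace ((1 + 1) * x) with (2 * x) in * by ring.
    rewrite sin_2a.
    assert (0 < sin x) by (apply sin_gt_0; lra).
    assert (cos x < 1)
      by (rewrite <- cos_0; apply cos_decreasing_1; lra).
    pose proof (Rmult_lt_compat_l (sin x) (cos x) 1).
    lra.
  - replace (S k) with (k + 1)%nat in * by lia.
    rewrite !plus_INR in *; simpl INR in *.
    set (K := INR k) in *.
    assert (HK : 0 <= K) by apply pos_INR.
    assert (HKx : 0 <= K * x) by (apply Rmult_le_pos; lra).
    specialize (IH ltac:(lra)).
    assert (Hsin : 0 <= sin ((K + 1) * x)) by (apply sin_ge_0; lra).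
    (* This recurrence eliminates the sine of the largest multiple; the goal is then the sum of [IH]
       and [Hcos]. *)
    assert (Hsum : sin (K * x) + sin ((K + 1 + 1) * x)
                   = 2 * cos x * sin ((K + 1) * x)).
    { replace (K * x) with ((K + 1) * x - x) by ring.
      replace ((K + 1 + 1) * x) with ((K + 1) * x + x) by ring.
      rewrite sin_minus, sin_plus; ring. }
    assert (Hcos : 0 <= (K + 1) * (2 * (1 - cos x) * sin ((K + 1) * x))).
    { pose proof (COS_bound x).
      repeat apply Rmult_le_pos; lra. }
    replace (sin ((K + 1 + 1) * x))
      with (2 * cos x * sin ((K + 1) * x) - sin (K * x)) by lra.
    lra.
Qed.

Lemma sin_mult_lt (x : R) (m n : nat) :
  0 < x -> (1 <= m)%nat -> (m < n)%nat -> INR n * x <= PI ->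
  INR m * sin (INR n * x) < INR n * sin (INR m * x).
Proof.
  intros Hx Hm Hmn.
  induction Hmn as [| n Hmn IH]; intros Hpi.
  - replace (S m) with (m + 1)%nat in * by lia.
    now apply sin_mult_succ_lt.
  - replace (S n) with (n + 1)%nat in * by lia.
    pose proof (sin_mult_succ_lt x n Hx ltac:(lia) Hpi) as Hstep.
    rewrite plus_INR in *; simpl INR in *.
    specialize (IH ltac:(lra)).
    assert (0 < INR m) by (apply lt_0_INR; lia).
    assert (0 < INR n) by (apply lt_0_INR; lia).
    (* After scaling, both inequalities share the term [m (n + 1) sin (n x)]; chaining them leaves a
       common factor [n] to cancel. *)
    apply (Rmult_lt_compat_l (INR m)) in Hstep; [| assumption].
    apply (Rmult_lt_compat_l (INR n + 1)) in IH; [| lra].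
    apply (Rmult_lt_reg_l (INR n)); [assumption | lra].
Qed.

Lemma arithmetic_progression (t : nat -> R) (d : R) (n : nat) :
  t 1%nat = 0 -> (forall i, (1 <= i <= n)%nat -> t (i + 1)%nat - t i = d) ->
  forall k, (k <= n)%nat -> t (k + 1)%nat = INR k * d.
Proof.
  intros H1 Hd k; induction k as [| k IH]; intros Hk.
  - simpl; lra.
  - pose proof (Hd (S k) ltac:(lia)) as H.
    specialize (IH ltac:(lia)).
    rewrite S_INR; replace (k + 1)%nat with (S k) in IH by lia; lra.
Qed.

Theorem theorem2 (A : arc) (hA : less_than_half_circle A)
    (n : nat) (hn : (1 <= n)%nat)
    (P : nat -> point) (hP : clockwise_partition A n P) (hreg : regular n P)
    (m : nat) (hm : (1 <= m)%nat) (hmn : (m < n)%nat) :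
  INR n * distance (P 1%nat) (P (m + 1)%nat) > INR m * distance (P 1%nat) (P (n + 1)%nat).
Proof.
  destruct hP as [[t [Ht Hmono]] [Hfirst Hlast]].
  unfold less_than_half_circle in hA.
  pose proof (arc_radius_pos A) as Hr.
  pose proof (arc_angle_pos A) as Ha.
  (* The partition fixes the end points only as points of the plane; injectivity turns this into
     values of [t]. *)
  assert (Ht1 : t 1%nat = 0).
  { destruct (Ht 1%nat ltac:(lia)) as [Hb HP].
    apply (arc_point_inj A); [lra | lra | congruence]. }
  assert (Htn : t (n + 1)%nat = arc_angle A).
  { destruct (Ht (n + 1)%nat ltac:(lia)) as [Hb HP].
    apply (arc_point_inj A); [lra | lra | congruence]. }
  assert (Hstep : forall i, (1 <= i <= n)%nat ->
            t (i + 1)%nat - t i = t (1 + 1)%nat - t 1%nat).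
  { intros i Hi.
    pose proof (hreg i 1%nat Hi ltac:(lia)) as E.
    destruct (Ht i ltac:(lia)) as [Bi Pi].
    destruct (Ht (i + 1)%nat ltac:(lia)) as [Bi' Pi'].
    destruct (Ht 1%nat ltac:(lia)) as [B1 P1].
    destruct (Ht (1 + 1)%nat ltac:(lia)) as [B1' P1'].
    pose proof (Hmono i Hi) as Mi.
    pose proof (Hmono 1%nat ltac:(lia)) as M1.
    rewrite Pi, Pi', P1, P1', !distance_arc_point in E by lra.
    apply Rmult_eq_reg_l in E; [| lra].
    (* Half of each gap is at most [arc_angle A / 2 < PI / 2], in the range where sine is
       injective. *)
    apply sin_inj in E; lra. }
  set (d := t (1 + 1)%nat - t 1%nat) in Hstep.
  pose proof (arithmetic_progression t d n Ht1 Hstep) as Hk.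
  assert (Hnd : INR n * d = arc_angle A) by (rewrite <- Hk; [exact Htn | lia]).
  (* The ordering alone allows [d = 0]; the positive total angle [n d] excludes it. *)
  assert (Hd : 0 < d).
  { apply (Rmult_lt_reg_l (INR n)); [apply lt_0_INR; lia | lra]. }
  assert (Hdist : forall k, (k <= n)%nat ->
            distance (P 1%nat) (P (k + 1)%nat)
            = 2 * arc_radius A * sin (INR k * (d / 2))).
  { intros k Hkn.
    destruct (Ht (k + 1)%nat ltac:(lia)) as [Bk Pk].
    rewrite Hfirst, Pk, distance_arc_point, Hk by (lra || lia).
    do 2 f_equal; field. }
  rewrite !Hdist by lia.
  (* Here [x] is half the common central angle, so [n x = arc_angle A / 2]. *)
  pose proof (sin_mult_lt (d / 2) m n ltac:(lra) hm hmn ltac:(lra)) as H.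
  apply (Rmult_lt_compat_l (2 * arc_radius A)) in H; lra.
Qed.
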